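(* Let $m \geq 2$ be an integer and $n=3$. Then $\mathbb{Z}_m^3$ is $H$-closed if one of the following occurs: (1) $m$ is a power of $2$. Specifically, if $\mathbf{u} \in K(\mathbb{Z}_m^3)$, then $D^2(\mathbf{u})=H(\mathbf{u})$. (2) $m$ is prime and $m \equiv 5 \pmod 6$. Specifically, $D^{m-1}(\mathbf{u})=H^2(\mathbf{u})$ for every $\mathbf{u} \in \mathbb{Z}_m^3$. (3) $m=2^l p$ for some $l \in \mathbb{Z}^+$ and some prime $p \equiv 5 \pmod 6$. Specifically, if $\mathbf{u} \in K(\mathbb{Z}_m^3)$, then $D^{p-1}(\mathbf{u})=H^2(\mathbf{u})$.
   Context: For integers $n \geq 2$, $m \geq 2$, the Ducci function is the endomorphism $D$ of $\mathbb{Z}_m^n$ given by $D(x_1,\dots,x_n)=(x_1+x_2 \bmod m, x_2+x_3 \bmod m,\dots,x_n+x_1 \bmod m)$, and $H$ is the endomorphism $H(x_1,\dots,x_n)=(x_2,x_3,\dots,x_n,x_1)$; $H^{\beta}$ for negative $\beta$ denotes the inverse power. The Ducci sequence of $\mathbf{u}$ is $\{D^{\alpha}(\mathbf{u})\}_{\alpha \geq 0}$. The Ducci cycle of $\mathbf{u}$ is the set of $\mathbf{v}$ for which there exist integers $\alpha \geq 0$, $\beta \geq 1$ with $\mathbf{v}=D^{\alpha+\beta}(\mathbf{u})=D^{\alpha}(\mathbf{u})$. $K(\mathbb{Z}_m^n)$ is the set of all tuples in $\mathbb{Z}_m^n$ that belong to the Ducci cycle of some $\mathbf{u} \in \mathbb{Z}_m^n$.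 The Ducci sequence of $\mathbf{u}$ is called $H$-closed if for every $\mathbf{v}$ in the Ducci cycle of $\mathbf{u}$ and every $-n<\beta<n$, $H^{\beta}(\mathbf{v})$ also belongs to the Ducci cycle of $\mathbf{u}$; $\mathbb{Z}_m^n$ is called $H$-closed if the Ducci sequence of every $\mathbf{u} \in \mathbb{Z}_m^n$ is $H$-closed. *)

(* Defs.v *)
From mathcomp Require Import all_boot all_order all_algebra.

Set Implicit Arguments.
Unset Strict Implicit.
Unset Printing Implicit Defensive.

Import GRing.Theory.
Local Open Scope ring_scope.

(* Tuples in (Z/m)^n are row vectors with 0-based coordinates.  The library's
   'Z_m is Z/m only when 1 < m, so every statement must assume 1 < m. *)

Section Ducci.

Variables m n : nat.
Implicit Types u v : 'rV['Z_m]_n.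

(* [ordS] and [ord_pred] are the successor and predecessor modulo n. *)
Definition ducciD u : 'rV['Z_m]_n := \row_i (u 0 i + u 0 (ordS i)).

Definition ducciH u : 'rV['Z_m]_n := \row_i u 0 (ordS i).

Definition ducciHinv u : 'rV['Z_m]_n := \row_i u 0 (ord_pred i).

Lemma ducciHK : cancel ducciH ducciHinv.
Proof. by move=> u; apply/rowP => i; rewrite !mxE ord_predK. Qed.

Lemma ducciHinvK : cancel ducciHinv ducciH.
Proof. by move=> u; apply/rowP => i; rewrite !mxE ordSK. Qed.

(* [Negz k] is the integer - k.+1. *)
Definition ducciHz (b : int) u : 'rV['Z_m]_n :=
  match b with
  | Posz k => iter k ducciH u
  | Negz k => iter k.+1 ducciHinv u
  end.

Definition in_ducci_cycle u v : Prop :=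
  exists a b : nat,
    [/\ (1 <= b)%N, v = iter (a + b) ducciD u & v = iter a ducciD u].

Definition in_ducciK v : Prop := exists u, in_ducci_cycle u v.

Definition seq_Hclosed u : Prop :=
  forall v, in_ducci_cycle u v ->
  forall b : int, - n%:Z < b -> b < n%:Z -> in_ducci_cycle u (ducciHz b v).

End Ducci.

Definition Hclosed (m n : nat) : Prop :=
  forall u : 'rV['Z_m]_n, seq_Hclosed u.

(* Main.v *)
Require Import Defs.
From mathcomp Require Import all_boot all_order all_algebra.
From mathcomp Require Import zify.

(** In matrix form H is the cyclic shift S and D is 1 + S, with S^3 = 1.  Put
    N = 1 + S + S^2; then D^2 = S + N and D N = 2 N.  On a D-periodic vector any
    power of D acts injectively, so c 2^l = 0 gives c N v = 0, that is,
    c D^2 v = c H v: this settles m = 2^l (c = 1).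
    For a prime p = 2 (mod 3), D^p = 1 + S^p = S^2 D modulo p, so D kills
    c (D^(p-1) - S^2) v as soon as c p = 0.  For m = 2^l p the two arguments,
    with c = p and c = 2^l, show that the vector D^(p-1) v - H^2 v is killed by
    the coprime integers p and 2^l.  For m = p odd, D is injective because
    D (1 - S + S^2) = 2. *)

Import GRing.Theory.
Local Open Scope ring_scope.

(** The inner binomial coefficients are divisible by [p]. The multiple of [p] stays explicit because
    [p] need not vanish in ['Z_m]. *)
Lemma exprD1_prime (R : nzRingType) (x : R) (p : nat) : prime p ->
  exists y : R, (1 + x) ^+ p = 1 + x ^+ p + y *+ p.
Proof.
move=> p_pr; have p_gt0 := prime_gt0 p_pr.
exists (\sum_(1 <= i < p) x ^+ i *+ ('C(p, i) %/ p)).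
rewrite addrC exprD1n -(big_mkord xpredT (fun i => x ^+ i *+ 'C(p, i))).
rewrite big_nat_recr // big_ltn //= bin0 binn expr0 !mulr1n.
rewrite -addrA -sumrMnl -addrA; congr (_ + _).
rewrite addrC; congr (_ + _).
rewrite !big_nat; apply: eq_bigr => i /andP[i_gt0 i_ltp].
by rewrite -mulrnA divnK // prime_dvd_bin // i_gt0.
Qed.

(** Bezout over the naturals: some [u * a] exceeds some [v * b] by exactly 1. *)
Lemma coprime_mulrn_eq0 (V : zmodType) (x : V) (a b : nat) :
  (0 < a)%N -> coprime a b -> x *+ a = 0 -> x *+ b = 0 -> x = 0.
Proof.
move=> a_gt0 /eqP cab xa xb.
have [u v def_uv _] := egcdnP b a_gt0.
have: x *+ (u * a) = x *+ (v * b + gcdn a b) by rewrite def_uv.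
by rewrite cab mulrnDr mulr1n (mulnC u) (mulnC v) !mulrnA xa xb !mul0rn add0r.
Qed.

Section CyclicShift.

Variable m : nat.

Definition shift_mx : 'M['Z_m]_3 := \matrix_(i, j) (i == ordS j)%:R.

Local Notation S := shift_mx.
Local Notation D := (1 + shift_mx).
Local Notation N := (1 + S + S ^+ 2).

Implicit Types (u v w : 'rV['Z_m]_3) (A : 'M['Z_m]_3).

Lemma ducciHE u : ducciH u = u *m S.
Proof.
apply/rowP => j; rewrite !mxE (bigD1 (ordS j)) //= mxE eqxx mulr1.
by rewrite big1 ?addr0 // => i /negPf ne; rewrite mxE ne mulr0.
Qed.

Lemma ducciDE u : ducciD u = u *m D.
Proof. by rewrite mulmxDr mulmx1 -ducciHE; apply/rowP => j; rewrite !mxE. Qed.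

Lemma iter_mulmx (f : 'rV['Z_m]_3 -> 'rV['Z_m]_3) A k u :
  (forall u, f u = u *m A) -> iter k f u = u *m A ^+ k.
Proof.
move=> fE; elim: k => [|k IHk]; first by rewrite expr0 mulmx1.
by rewrite iterS IHk fE -mulmxA exprSr.
Qed.

Lemma iter_ducciD k u : iter k (@ducciD m 3) u = u *m D ^+ k.
Proof. exact/iter_mulmx/ducciDE. Qed.

Lemma iter_ducciH k u : iter k (@ducciH m 3) u = u *m S ^+ k.
Proof. exact/iter_mulmx/ducciHE. Qed.

Lemma shift_mx3 : S ^+ 3 = 1.
Proof.
apply/row_matrixP => i; rewrite !rowE -iter_ducciH mulmx1.
apply/rowP => j; rewrite !mxE; congr (_ && (_ == _))%:R.
by apply/val_inj; case: j => [[|[|[|]]]].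
Qed.

Lemma ducciHinvE u : ducciHinv u = u *m S ^+ 2.
Proof.
by rewrite -{2}[u]ducciHinvK ducciHE -mulmxA -[S *m _]exprS shift_mx3 mulmx1.
Qed.

Lemma shift_mx_modn k : S ^+ k = S ^+ (k %% 3).
Proof.
by rewrite {1}(divn_eq k 3) exprD mulnC exprM shift_mx3 expr1n mul1r.
Qed.

Lemma Dsqr : D ^+ 2 = S + N.
Proof. by rewrite expr2 mulrDl mul1r mulrDr mulr1 -expr2 addrCA. Qed.

(** Multiplication by [S] permutes the three terms of [N], so [N * S = N] and each factor [D]
    doubles [N]. *)
Lemma D_N k : N * D ^+ k = N *+ (2 ^ k).
Proof.
have NS : N * S = N.
  by rewrite !mulrDl mul1r -!expr2 -exprSr shift_mx3 addrC addrA.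
elim: k => [|k IHk]; first by rewrite expr0 mulr1.
by rewrite [D ^+ _]exprSr mulrA IHk mulrnAl mulrDr mulr1 NS -mulr2n -mulrnA -expnS.
Qed.

(** The factorization of [1 + S ^+ 3], where [S ^+ 3 = 1]. *)
Lemma D_quad : D * (1 - S + S ^+ 2) = 2%:R.
Proof.
rewrite mulrDl mul1r !mulrDr mulr1 mulrN -expr2 -exprS shift_mx3.
by rewrite addrA addrACA subrr addr0 subrK.
Qed.

Lemma mulmx_mulrnl A k v : v *m (A *+ k) = (v *m A) *+ k.
Proof. exact: raddfMn. Qed.

Lemma mulrn_mulmx A k v : (v *+ k) *m A = (v *m A) *+ k.
Proof. exact: (raddfMn (mulmxr A)). Qed.

(** Equivalent to [in_ducciK v], but free of the starting tuple, hence easily transported along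
    matrices commuting with [D]. *)
Definition ducci_periodic v := exists2 b, (0 < b)%N & v *m D ^+ b = v.

Lemma in_cycle_periodic u v : in_ducci_cycle u v -> ducci_periodic v.
Proof.
move=> [a [b [b_gt0 vab va]]]; exists b => //.
by rewrite -iter_ducciD {1}va -iterD addnC.
Qed.

Lemma in_cycle_iter u v k :
  in_ducci_cycle u v -> in_ducci_cycle u (v *m D ^+ k).
Proof.
move=> [a [b [b_gt0 vab va]]]; exists (k + a)%N, b; split=> //.
  by rewrite -addnA iterD -vab iter_ducciD.
by rewrite iterD -va iter_ducciD.
Qed.

Lemma periodic_mulmx A v : GRing.comm D A ->
  ducci_periodic v -> ducci_periodic (v *m A).
Proof.
move=> cDA [b b_gt0 vb]; exists b => //.
by rewrite -mulmxA (_ : A *m _ = D ^+ b * A) ?mulmxA ?vb //; apply: commrX.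
Qed.

Lemma periodic_mulrn k v : ducci_periodic v -> ducci_periodic (v *+ k).
Proof. by move=> [b b_gt0 vb]; exists b => //; rewrite mulrn_mulmx vb. Qed.

Lemma periodic_eq0 k v : ducci_periodic v -> v *m D ^+ k = 0 -> v = 0.
Proof.
move=> [b b_gt0 vb] vk.
(* A period that is at least [k]: the return to [v] then passes through [v *m D ^+ k], which is
   zero. *)
have vbk : v *m D ^+ (b * k) = v.
  elim: {vk} k => [|k IHk]; first by rewrite muln0 expr0 mulmx1.
  by rewrite mulnS exprD mulmxA vb.
rewrite -vbk -(subnKC (leq_pmull k b_gt0)) exprD mulmxA vk; exact: mul0mx.
Qed.

Lemma commD_S : GRing.comm D S.
Proof. exact/commr_sym/commrD/commr_refl/commr1. Qed.

Lemma commD_N : GRing.comm D N.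
Proof.
apply: commrD; last exact/commrX/commD_S.
by apply: commrD; [apply: commr1 | apply: commD_S].
Qed.

Hypothesis m_gt1 : (1 < m)%N.

Lemma mulrn_modulus v : v *+ m = 0.
Proof. by rewrite -scaler_nat pchar_Zp // scale0r. Qed.

Lemma periodic_sqr c l v : m = (2 ^ l * c)%N -> ducci_periodic v ->
  (v *m D ^+ 2) *+ c = (v *m S) *+ c.
Proof.
move=> def_m v_per; rewrite Dsqr mulmxDr mulrnDl.
suff ->: (v *m N) *+ c = 0 by rewrite addr0.
(* [D ^+ l] turns [N] into [2 ^ l] times [N]; with the factor [c] this is a multiple by the
   modulus. *)
apply: (@periodic_eq0 l).
  exact/periodic_mulrn/periodic_mulmx/v_per/commD_N.
rewrite mulrn_mulmx -mulmxA [N *m _]D_N mulmx_mulrnl -mulrnA -def_m.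
exact: mulrn_modulus.
Qed.

Lemma periodic_even_pow c l v k : m = (2 ^ l * c)%N -> ducci_periodic v ->
  (v *m D ^+ (2 * k)) *+ c = (v *m S ^+ k) *+ c.
Proof.
move=> def_m; elim: k v => [|k IHk] v v_per; first by rewrite muln0.
rewrite mulnS exprD mulmxA -mulrn_mulmx (periodic_sqr _ _ _ def_m v_per).
rewrite mulrn_mulmx IHk ?exprS ?mulmxA //.
exact/periodic_mulmx/v_per/commD_S.
Qed.

Lemma prime_Dpow c p v : prime p -> p = 5 %[mod 6] -> m = (c * p)%N ->
  ((v *m D ^+ p.-1 - v *m S ^+ 2) *+ c) *m D = 0.
Proof.
move=> p_pr p5 def_m; have [y Dp] := exprD1_prime _ S p p_pr.
(* The extra factor [D] raises the exponent [p.-1] to [p], where the binomial expansion applies. *)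
rewrite mulrn_mulmx mulmxBl -!(mulmxA v) -[_ *m D]exprSr prednK ?prime_gt0 //.
rewrite Dp (shift_mx_modn p) (_ : (p %% 3)%N = 2%N); last by lia.
rewrite (_ : S ^+ 2 *m D = 1 + S ^+ 2); last first.
  by rewrite [_ *m D]mulrDr mulr1 -exprSr shift_mx3 addrC.
rewrite -mulmxBr addrC addKr mulmx_mulrnl -mulrnA mulnC -def_m.
exact: mulrn_modulus.
Qed.

(** As [j] is invertible modulo 3, every power of [S] is a power of [S ^+ j], so it acts on periodic
    vectors as a power of [D] and stays in the cycle. *)
Lemma Hclosed_of_pow k j :
  (forall v, ducci_periodic v -> v *m D ^+ k = v *m S ^+ j) ->
  coprime j 3 -> Hclosed m 3.
Proof.
move=> DS coj3 u v v_cyc b _ _.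
have powDS i w : ducci_periodic w -> w *m D ^+ (k * i) = w *m S ^+ (j * i).
  elim: i w => [|i IHi] w w_per; first by rewrite !muln0.
  rewrite !mulnS !exprD !mulmxA DS // IHi //.
  exact/periodic_mulmx/w_per/commrX/commD_S.
have{powDS} in_cyc i : in_ducci_cycle u (v *m S ^+ i).
  (* A unit modulo 3 is its own inverse: [j * j] is 1 modulo 3. *)
  suff ->: S ^+ i = S ^+ (j * (j * i)).
    by rewrite -powDS; [apply: in_cycle_iter | apply: in_cycle_periodic v_cyc].
  rewrite mulnA exprM (shift_mx_modn (j * j)).
  suff ->: (j * j %% 3 = 1)%N by [].
  move: coj3; rewrite coprime_sym prime_coprime // -modnMml -modnMmr /dvdn.
  by case: (j %% 3)%N (ltn_pmod j (isT : 0 < 3)%N) => [|[|[|]]].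
case: b => i /=; first by rewrite iter_ducciH.
(* Negative shifts are also powers of [S], the inverse of [S] being [S ^+ 2]. *)
rewrite -iterS (iter_mulmx _ _ _ _ ducciHinvE) -exprM; exact: in_cyc.
Qed.

End CyclicShift.

Theorem theorem1 (m : nat) (hm : (2 <= m)%N) :
  [/\ forall l : nat, m = (2 ^ l)%N ->
        Hclosed m 3 /\
        (forall u : 'rV['Z_m]_3, in_ducciK u -> iter 2 (@ducciD m 3) u = ducciH u),
      prime m -> m = 5 %[mod 6] ->
        Hclosed m 3 /\
        (forall u : 'rV['Z_m]_3,
           iter (m - 1) (@ducciD m 3) u = iter 2 (@ducciH m 3) u)
    & forall l p : nat, (0 < l)%N -> prime p -> p = 5 %[mod 6] ->
        m = (2 ^ l * p)%N ->
        Hclosed m 3 /\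
        (forall u : 'rV['Z_m]_3, in_ducciK u ->
           iter (p - 1) (@ducciD m 3) u = iter 2 (@ducciH m 3) u)].
Proof.
split=> [l def_m | m_pr m5 | l p l_gt0 p_pr p5 def_m].
- have key v : ducci_periodic m v ->
      v *m (1 + shift_mx m) ^+ 2 = v *m shift_mx m ^+ 1.
    move=> v_per; have := @periodic_sqr m hm 1 l v.
    by rewrite muln1 !mulr1n expr1; apply.
  split=> [|v [u /in_cycle_periodic v_per]]; first exact: Hclosed_of_pow key _.
  by rewrite iter_ducciD ducciHE key.
- have key (v : 'rV_3) : v *m (1 + shift_mx m) ^+ (m - 1) = v *m shift_mx m ^+ 2.
    rewrite subn1; apply/eqP; rewrite -subr_eq0; apply/eqP.
    set w := (w in w = 0).
    have wD : w *m (1 + shift_mx m) = 0.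
      have := @prime_Dpow m hm 1 m v m_pr m5.
      by rewrite mul1n mulr1n; apply.
    (* The congruence makes [m] odd; [w] is killed by [m], and by 2 because [D] divides 2. *)
    apply: (@coprime_mulrn_eq0 _ w 2 m) => //; last exact: mulrn_modulus.
      rewrite prime_coprime // dvdn2; lia.
    rewrite -[w]mulmx1 -mulmx_mulrnl -[1%:M *+ 2]D_quad mulmxA wD.
    exact: mul0mx.
  split=> [|v]; last by rewrite iter_ducciD iter_ducciH key.
  exact: (@Hclosed_of_pow m (m - 1) 2).
have key v : ducci_periodic m v ->
    v *m (1 + shift_mx m) ^+ (p - 1) = v *m shift_mx m ^+ 2.
  move=> v_per; rewrite subn1; apply/eqP; rewrite -subr_eq0; apply/eqP.
  set w := (w in w = 0).
  apply: (@coprime_mulrn_eq0 _ w (2 ^ l) p); first by rewrite expn_gt0.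
  - rewrite coprimeXl // prime_coprime // dvdn2; lia.
  (* Killed by [2 ^ l]: that multiple of [w] is periodic and [D] sends it to zero. *)
  - apply: (@periodic_eq0 m 1).
      apply/periodic_mulrn; rewrite /w -mulmxBr.
      apply: periodic_mulmx v_per; apply: commrB; apply: commrX.
        exact: commr_refl.
      exact: commD_S.
    rewrite expr1; exact: prime_Dpow.
  (* Killed by [p]: writing [p = 6q + 5] gives [p./2 = 3q + 2], so [D ^+ p.-1] acts on [v] as
     [S ^+ 2] up to the factor [p]. *)
  rewrite mulrnBl (_ : p.-1 = 2 * p./2)%N; last by lia.
  rewrite (@periodic_even_pow m hm p l) // shift_mx_modn.
  by rewrite (_ : p./2 %% 3 = 2)%N ?subrr //; lia.
split=> [|v [u /in_cycle_periodic v_per]].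
  exact: (@Hclosed_of_pow m (p - 1) 2).
by rewrite iter_ducciD iter_ducciH key.
Qed.
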